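(* Let $n\in\mathbb{N}_0$ and let $\lambda$ be a real number with $\lambda\neq 0$ and $\lambda\neq 1$. Define $$y(n,\lambda)=\sum_{j=0}^{n}\frac{(-1)^{n}}{(j+1)\lambda^{j+1}(\lambda-1)^{n+1-j}}.$$ Then $$y(n,\lambda)=\frac{-1}{\lambda}\sum_{j=0}^{n}\sum_{k=0}^{j}\binom{n+1}{j}\frac{B_{k}\,S_{1}(j,k)}{j!\,B_{j}^{n+1}(\lambda)}.$$
   Context: The Bernoulli numbers $B_n$ are defined by $\frac{t}{e^t-1}=\sum_{n\ge 0}B_n\frac{t^n}{n!}$ ($|t|<2\pi$). The Stirling numbers of the first kind $S_1(n,k)$ are defined by $\frac{(\log(1+z))^k}{k!}=\sum_{n\ge0}S_1(n,k)\frac{z^n}{n!}$, with $S_1(n,k)=0$ for $k>n$. The Bernstein basis functions are $B_j^{n}(\lambda)=\binom{n}{j}\lambda^j(1-\lambda)^{n-j}$ for $j\in\{0,1,\dots,n\}$. *)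

(* Defs.v *)
From Stdlib Require Import Reals Factorial.
From Coquelicot Require Import Coquelicot.
Open Scope R_scope.

(* The exponential generating function determines the sequence: two sequences
   satisfying one of the first two predicates are equal.  The point t = 0 is
   left out because there t / (exp t - 1) is a removable singularity, which
   Rocq's total division would evaluate to 0 instead of 1. *)
Definition is_bernoulli (B : nat -> R) : Prop :=
  forall t : R, t <> 0 -> Rabs t < 2 * PI ->
    is_pseries (fun n => B n / INR (fact n)) t (t / (exp t - 1)).

(* |z| < 1 is the disc of convergence of the series of log(1+z). *)
Definition is_stirling1 (S1 : nat -> nat -> R) : Prop :=
  (forall (k : nat) (z : R), Rabs z < 1 ->
     is_pseries (fun n => S1 n k / INR (fact n)) z
       (ln (1 + z) ^ k / INR (fact k))) /\
  (forall n k : nat, (n < k)%nat -> S1 n k = 0).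

(* Meaningful for j <= n only: Stdlib's Binomial.C n j is not 0 for j > n. *)
Definition bernstein (n j : nat) (lambda : R) : R :=
  Binomial.C n j * lambda ^ j * (1 - lambda) ^ (n - j).

Definition y (n : nat) (lambda : R) : R :=
  sum_f_R0
    (fun j => (-1) ^ n /
       (INR (j + 1) * lambda ^ (j + 1) * (lambda - 1) ^ (n + 1 - j))) n.

(* Main.v *)
(** Substituting [t = ln (1 + z)] in the two generating functions gives
    [ln (1 + z) / z = sum_k B_k (ln (1 + z))^k / k!], so that comparing
    coefficients of [z^j] yields
    [sum_(k <= j) B_k S_1(j, k) = (-1)^j j! / (j + 1)], from which the theorem
    follows term by term.  To avoid composing power series, the Bernoulli series
    is truncated after [t^j]: the remainder is [O(t^(j + 1)) = O(z^(j + 1))], and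
    a power series which is [O(z^(j + 1))] at [0] has no terms of degree at
    most [j]. *)
Require Import Defs.
From Stdlib Require Import Reals Factorial Lra Lia.
From Coquelicot Require Import Coquelicot.
Open Scope R_scope.

(** Outside the disc of convergence the terms do not tend to 0, so no series can converge there. *)
Lemma CV_radius_ge (a : nat -> R) (x : R) :
  ex_pseries a x -> Rbar_le (Rabs x) (CV_radius a).
Proof.
  intros [l H]; apply Rbar_not_lt_le; intros Hlt.
  apply (CV_disk_outside _ _ Hlt), ex_series_lim_0.
  exists l; now apply is_pseries_R.
Qed.

Lemma CV_radius_gt_0 (a : nat -> R) (x : R) :
  x <> 0 -> ex_pseries a x -> Rbar_lt 0 (CV_radius a).
Proof.
  intros Hx H; apply Rbar_lt_le_trans with (Rabs x).
  - now apply Rabs_pos_lt.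
  - now apply CV_radius_ge.
Qed.

(** Let z tend to 0: the series tends to its constant coefficient, the bound to 0. The neighbourhood
    is punctured because the bound will later be divided by [Rabs z]. *)
Lemma PSeries_bigO_const_coef (a : nat -> R) (M : R) (N : nat) :
  Rbar_lt 0 (CV_radius a) ->
  locally' 0 (fun z => Rabs (PSeries a z) <= M * Rabs z ^ S N) -> a 0%nat = 0.
Proof.
  intros Ha H.
  assert (Hle : Rbar_le (Rabs (PSeries a 0)) (M * Rabs 0 ^ S N)).
  { apply (is_lim_le_loc (fun z => Rabs (PSeries a z))
      (fun z => M * Rabs z ^ S N) 0); [exact H | |].
    - apply (is_lim_continuity (fun z => Rabs (PSeries a z))).
      apply (continuity_pt_comp (PSeries a) Rabs).
      + apply PSeries_continuity; now rewrite Rabs_R0.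
      + apply Rcontinuity_abs.
    - apply (is_lim_continuity (fun z => M * Rabs z ^ S N)); reg. }
  rewrite PSeries_0, Rabs_R0, pow_i, Rmult_0_r in Hle by lia; simpl in Hle.
  apply Rabs_eq_0, Rle_antisym; [assumption | apply Rabs_pos].
Qed.

(** Induction on [N]: once the constant coefficient vanishes, the series is z times its shift
    [PS_decr_1 a], and dividing the bound by [Rabs z] lowers the exponent by one. Hence [a] is
    quantified inside the induction. *)
Lemma PSeries_bigO_coef_eq_0 (N : nat) (M : R) : forall a : nat -> R,
  Rbar_lt 0 (CV_radius a) ->
  locally' 0 (fun z => Rabs (PSeries a z) <= M * Rabs z ^ S N) ->
  forall n, (n <= N)%nat -> a n = 0.
Proof.
  induction N as [|N IH]; intros a Ha H;
    pose proof (PSeries_bigO_const_coef _ _ _ Ha H) as H0.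
  - intros n Hn; now replace n with 0%nat by lia.
  - intros [|n] Hn; [assumption|].
    apply (IH (PS_decr_1 a)); [now rewrite CV_radius_decr_1 | | lia].
    destruct H as [r Hr]; exists r; intros z Hzr Hz; specialize (Hr z Hzr Hz).
    assert (Hzp : 0 < Rabs z) by now apply Rabs_pos_lt.
    rewrite (PSeries_ext a (PS_incr_1 (PS_decr_1 a))), PSeries_incr_1, Rabs_mult
      in Hr by (intros [|k]; [assumption | reflexivity]).
    apply Rmult_le_reg_l with (Rabs z); [assumption|].
    eapply Rle_trans; [exact Hr|].
    apply Req_le; simpl; ring.
Qed.

Lemma PSeries_locally_bounded (a : nat -> R) :
  Rbar_lt 0 (CV_radius a) ->
  locally 0 (fun z => Rabs (PSeries a z) <= Rabs (a 0%nat) + 1).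
Proof.
  intros Ha.
  assert (Hc : continuity_pt (PSeries a) 0)
    by (apply PSeries_continuity; now rewrite Rabs_R0).
  apply continuity_pt_filterlim in Hc.
  apply (proj1 (filterlim_locally _ _)) with (eps := mkposreal 1 Rlt_0_1) in Hc.
  revert Hc; apply filter_imp; intros z Hz.
  rewrite PSeries_0 in Hz; change (Rabs (PSeries a z - a 0%nat) < 1) in Hz.
  pose proof (Rabs_triang_inv (PSeries a z) (a 0%nat)); lra.
Qed.

(** Both sides come from 1 + x <= exp x, taken at x = z and at x = 1 / (1 + z) - 1 = - z / (1 + z);
    the factor 2 bounds 1 / (1 + z) when |z| <= 1/2. *)
Lemma Rabs_ln_1p_le (z : R) : Rabs z <= 1 / 2 -> Rabs (ln (1 + z)) <= 2 * Rabs z.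
Proof.
  intros Hz; destruct (Rabs_le_between z (1 / 2)) as [Hb _]; specialize (Hb Hz).
  assert (Hup : ln (1 + z) <= z).
  { rewrite <- (ln_exp z) at 2; apply ln_le; [lra | apply exp_ineq1_le]. }
  assert (Hlow : - ln (1 + z) <= / (1 + z) - 1).
  { rewrite <- ln_Rinv, <- (ln_exp (/ (1 + z) - 1)) by lra.
    apply ln_le; [apply Rinv_0_lt_compat; lra|].
    pose proof (exp_ineq1_le (/ (1 + z) - 1)); lra. }
  assert (Hq : / (1 + z) - 1 = - z * / (1 + z)) by (field; lra).
  assert (Hi : 0 < / (1 + z) <= 2).
  { split; [apply Rinv_0_lt_compat; lra|].
    rewrite <- (Rinv_inv 2); apply Rinv_le_contravar; lra. }
  apply Rabs_le; unfold Rabs; destruct (Rcase_abs z); nra.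
Qed.

(** The termwise derivative represents 1 / (1 + z), as does the geometric series in - z, so the
    coefficients of the two agree. *)
Lemma is_pseries_ln_1p_coef (a : nat -> R) :
  (forall z, Rabs z < 1 -> is_pseries a z (ln (1 + z))) ->
  forall n, a (S n) = (-1) ^ n / INR (S n).
Proof.
  intros Ha n.
  assert (Hcv : Rbar_lt 0 (CV_radius a)).
  { apply CV_radius_gt_0 with (1 / 2); [lra|].
    eexists; apply Ha; rewrite Rabs_pos_eq; lra. }
  assert (Hgeom : forall z, Rabs z < 1 ->
    is_pseries (fun k => (-1) ^ k) z (/ (1 + z))).
  { intros z Hz; apply is_pseries_R.
    replace (1 + z) with (1 - - z) by ring.
    apply is_series_ext with (fun k => (- z) ^ k).
    - intros k; rewrite <- Rpow_mult_distr; f_equal; ring.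
    - apply is_series_geom; now rewrite Rabs_Ropp. }
  assert (H : PS_derive a n = (-1) ^ n).
  { apply (PSeries_ext_recip (PS_derive a) (fun k => (-1) ^ k)).
    - now rewrite CV_radius_derive.
    - apply CV_radius_gt_0 with (1 / 2); [lra|].
      eexists; apply Hgeom; rewrite Rabs_pos_eq; lra.
    - exists (mkposreal 1 Rlt_0_1); intros z Hz.
      change (Rabs (z - 0) < 1) in Hz; rewrite Rminus_0_r in Hz.
      assert (Hz' : -1 < z < 1) by now apply Rabs_lt_between.
      rewrite (is_pseries_unique _ _ _ (Hgeom z Hz)), <- Derive_PSeries.
      + apply is_derive_unique, is_derive_ext_loc with (fun t => ln (1 + t)).
        * apply (locally_interval _ z (-1) 1); simpl; try lra.
          intros t Ht1 Ht2; symmetry; apply is_pseries_unique, Ha.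
          now apply Rabs_lt_between.
        * auto_derive; [lra | field; lra].
      (* The midpoint of |z| and 1 is still a point of convergence, which puts z strictly inside the
         disc. *)
      + apply Rbar_lt_le_trans with (Rabs ((1 + Rabs z) / 2)).
        * pose proof (Rabs_pos z); rewrite (Rabs_pos_eq (_ / 2)); simpl; lra.
        * apply CV_radius_ge; eexists; apply Ha.
          pose proof (Rabs_pos z); rewrite Rabs_pos_eq; lra. }
  unfold PS_derive in H; rewrite <- H; field; now apply not_0_INR.
Qed.

Lemma is_pseries_sum_f_R0 (a : nat -> nat -> R) (l : nat -> R) (z : R) (N : nat) :
  (forall k, is_pseries (a k) z (l k)) ->
  is_pseries (fun n => sum_f_R0 (fun k => a k n) N) z (sum_f_R0 l N).
Proof.
  intros H; induction N as [|N IH]; [apply H|].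
  exact (is_pseries_plus _ _ _ _ _ IH (H (S N))).
Qed.

Lemma sum_bernoulli_stirling1 (B : nat -> R) (S1 : nat -> nat -> R) (j : nat) :
  is_bernoulli B -> is_stirling1 S1 ->
  sum_f_R0 (fun k => B k * S1 j k) j / INR (fact j) = (-1) ^ j / INR (S j).
Proof.
  intros hB [hS _].
  (* In powers of z, [g] expands t = ln (1 + z), and [s] expands the Bernoulli series [b] in t
     truncated after t^j. *)
  set (b := fun k => B k / INR (fact k)).
  set (g := fun n => S1 n 1%nat / INR (fact n)).
  set (s := fun n => sum_f_R0 (fun k => B k * (S1 n k / INR (fact n))) j).
  assert (Hg : forall z, Rabs z < 1 -> is_pseries g z (ln (1 + z))).
  { intros z Hz; replace (ln (1 + z)) with (ln (1 + z) ^ 1 / INR (fact 1))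
      by (simpl; field).
    now apply hS. }
  assert (Hg0 : g 0%nat = 0).
  { rewrite <- PSeries_0, (is_pseries_unique g 0 (ln (1 + 0))).
    - now rewrite Rplus_0_r, ln_1.
    - apply Hg; rewrite Rabs_R0; lra. }
  assert (Hs : forall z, Rabs z < 1 ->
    is_pseries s z (sum_f_R0 (fun k => b k * ln (1 + z) ^ k) j)).
  { intros z Hz.
    apply (is_pseries_sum_f_R0 (fun k n => B k * (S1 n k / INR (fact n)))).
    intros k; unfold b.
    replace (B k / INR (fact k) * ln (1 + z) ^ k)
      with (B k * (ln (1 + z) ^ k / INR (fact k)))
      by (field; apply INR_fact_neq_0).
    apply (is_pseries_scal (B k) (fun n => S1 n k / INR (fact n)));
      [apply Rmult_comm | now apply hS]. }
  (* The remainder of the truncation as a power series in z; since [g 0] is 0, shifting [g] divides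
     ln (1 + z) by z. *)
  assert (Hc : forall z, z <> 0 -> Rabs z < 1 ->
    is_pseries (PS_minus (PS_decr_1 g) s) z
      (ln (1 + z) / z - sum_f_R0 (fun k => b k * ln (1 + z) ^ k) j)).
  { intros z Hz0 Hz.
    apply (is_pseries_minus (PS_decr_1 g) s); [|now apply Hs].
    replace (ln (1 + z) / z) with (/ z * (ln (1 + z) - g 0%nat))
      by (rewrite Hg0; field; assumption).
    apply (is_pseries_decr_1 g z (/ z)); [now apply Rinv_l | now apply Hg]. }
  assert (Hb : Rbar_lt 0 (CV_radius b)).
  { apply CV_radius_gt_0 with 1; [lra|].
    eexists; apply hB; [lra|]. pose proof PI2_1. rewrite Rabs_R1; lra. }
  assert (H0 : PS_minus (PS_decr_1 g) s j = 0).
  (* The remainder is t^(j + 1) times the series of [d]. Near 0 that series is at most |d 0| + 1,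
     and |t| <= 2 |z| supplies the factor 2^(j + 1). *)
  { pose (d := PS_decr_n b (S j)).
    apply (PSeries_bigO_coef_eq_0 j ((Rabs (d 0%nat) + 1) * 2 ^ S j)); [| |lia].
    - apply CV_radius_gt_0 with (1 / 2); [lra|].
      eexists; apply Hc; [lra | rewrite Rabs_pos_eq; lra].
    - assert (Hd : Rbar_lt 0 (CV_radius d)).
      { unfold d; clear -Hb; induction (S j) as [|m IH].
        - now rewrite (CV_radius_ext _ b).
        - rewrite (CV_radius_ext _ (PS_decr_1 (PS_decr_n b m))).
          + now rewrite CV_radius_decr_1.
          + intros k; unfold PS_decr_1, PS_decr_n; f_equal; lia. }
      destruct (PSeries_locally_bounded d Hd) as [r Hr].
      (* The bound 1/2 permits |t| <= 2 |z|, and r / 2 then keeps t within the radius [r] on which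
         [d] is bounded. *)
      assert (Hm : 0 < Rmin (1 / 2) (r / 2))
        by (apply Rmin_pos; destruct r; simpl; lra).
      exists (mkposreal _ Hm); intros z Hz Hz0.
      change (Rabs (z - 0) < Rmin (1 / 2) (r / 2)) in Hz.
      rewrite Rminus_0_r in Hz.
      pose proof (Rmin_l (1 / 2) (r / 2)); pose proof (Rmin_r (1 / 2) (r / 2)).
      assert (Hln := Rabs_ln_1p_le z ltac:(lra)).
      assert (Hz' : - (1 / 2) < z < 1 / 2) by (apply Rabs_lt_between; lra).
      assert (Hexp : exp (ln (1 + z)) = 1 + z) by (apply exp_ln; lra).
      rewrite (is_pseries_unique _ _ _ (Hc z Hz0 ltac:(lra))).
      set (t := ln (1 + z)) in *.
      assert (Ht0 : t <> 0) by (intros E; rewrite E, exp_0 in Hexp; lra).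
      (* Here the substitution takes place: exp t - 1 = z, and |t| < 1 < 2 pi. *)
      assert (Hbt : is_pseries b t (t / z)).
      { replace z with (exp t - 1) at 1 by lra.
        apply hB; [assumption|]; pose proof PI2_1; lra. }
      rewrite <- (is_pseries_unique _ _ _ Hbt), (PSeries_decr_n b j)
        by now exists (t / z).
      fold d.
      replace (_ + _ - _) with (t ^ S j * PSeries d t) by ring.
      rewrite Rabs_mult, <- RPow_abs, Rmult_assoc, <- Rpow_mult_distr, Rmult_comm.
      apply Rmult_le_compat; [apply Rabs_pos | apply pow_le, Rabs_pos | |].
      + apply Hr; change (Rabs (t - 0) < r); rewrite Rminus_0_r; lra.
      + apply pow_incr; split; [apply Rabs_pos | assumption]. }
  (* The coefficient of z^j in the remainder, with the index of [g] raised by the shift. *)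
  change (g (S j) + - s j = 0) in H0.
  rewrite (is_pseries_ln_1p_coef g Hg) in H0.
  apply Rminus_diag_uniq_sym in H0; rewrite <- H0.
  unfold s, Rdiv; rewrite Rmult_comm, scal_sum.
  apply sum_eq; intros k _; ring.
Qed.

Lemma Binomial_C_neq_0 (n j : nat) : Binomial.C n j <> 0.
Proof.
  unfold Binomial.C; pose proof INR_fact_neq_0.
  apply Rmult_integral_contrapositive_currified; [auto|].
  now apply Rinv_neq_0_compat, Rmult_integral_contrapositive_currified.
Qed.

Theorem theorem1 (B : nat -> R) (S1 : nat -> nat -> R)
  (hB : is_bernoulli B) (hS1 : is_stirling1 S1)
  (n : nat) (lambda : R) (hl0 : lambda <> 0) (hl1 : lambda <> 1) :
  y n lambda =
    -1 / lambda *
    sum_f_R0 (fun j =>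
      sum_f_R0 (fun k =>
        Binomial.C (n + 1) j *
        (B k * S1 j k / (INR (fact j) * bernstein (n + 1) j lambda))) j) n.
Proof.
  unfold y; rewrite scal_sum; apply sum_eq; intros j Hj.
  assert (hl : 1 - lambda <> 0) by lra.
  pose proof (pow_nonzero _ j hl0) as Hpl.
  pose proof (pow_nonzero _ (n + 1 - j) hl) as Hpm.
  pose proof (Binomial_C_neq_0 (n + 1) j) as HC.
  pose proof (INR_fact_neq_0 j) as Hf.
  assert (HSj : INR (S j) <> 0) by now apply not_0_INR.
  (* The binomial coefficient cancels against the one in [bernstein], and the inner sum is then
     known. *)
  assert (E : sum_f_R0 (fun k => Binomial.C (n + 1) j *
      (B k * S1 j k / (INR (fact j) * bernstein (n + 1) j lambda))) j
    = (-1) ^ j / INR (S j) / (lambda ^ j * (1 - lambda) ^ (n + 1 - j))).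
  { rewrite <- (sum_bernoulli_stirling1 B S1 j hB hS1).
    unfold Rdiv; rewrite (Rmult_assoc (sum_f_R0 _ _)),
      (Rmult_comm (sum_f_R0 _ _)), scal_sum.
    apply sum_eq; intros k _; unfold bernstein; field; auto. }
  rewrite E.
  replace (lambda - 1) with (-1 * (1 - lambda)) by ring.
  rewrite Rpow_mult_distr, Nat.add_1_r; simpl (lambda ^ S j).
  (* Turning lambda - 1 into 1 - lambda costs (-1)^(n + 1 - j); the exponents j + 1 and n + 1 - j
     add up to n + 2, of the same parity as n. *)
  assert (Hs : (-1) ^ n = - (-1) ^ j * (-1) ^ (n + 1 - j)).
  { replace (- (-1) ^ j) with ((-1) ^ S j) by (simpl; ring).
    rewrite <- pow_add.
    replace (S j + (n + 1 - j))%nat with (n + 2)%nat by lia.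
    rewrite pow_add; simpl; ring. }
  rewrite Hs; pose proof (pow_nonzero (-1) (n + 1 - j) ltac:(lra)).
  field; auto.
Qed.
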